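(* For every odd positive integer $n$, every irreducible factor in $\mathbb{Z}[x]$ of the Fibonacci polynomial $F_n(x)$ is monogenic.
   Context: The Fibonacci polynomials $F_n(x)\in\mathbb{Z}[x]$ are defined by $F_0(x)=0$, $F_1(x)=1$, and $F_n(x)=xF_{n-1}(x)+F_{n-2}(x)$ for $n\ge 2$. A non-zero irreducible polynomial $f(x)\in\mathbb{Z}[x]$ is called monogenic if there exists a root $\alpha$ of $f(x)$ such that $\mathbb{Z}[\alpha]$ is exactly the ring of integers of the field $\mathbb{Q}(\alpha)$. *)

(* Defs.v *)
From mathcomp Require Import all_boot all_order all_algebra all_field.

Set Implicit Arguments.
Unset Strict Implicit.
Unset Printing Implicit Defensive.

Import GRing.Theory Num.Theory.
Local Open Scope ring_scope.

Fixpoint fibpoly (n : nat) : {poly int} :=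
  if n is m.+1 then
    if m is k.+1 then 'X * fibpoly m + fibpoly k else 1
  else 0.

(* Irreducibility and divisibility are stated ring-theoretically because       *)
(* polydiv's irreducible_poly and %| are defined by pseudo-division: on        *)
(* {poly int} they are the notions over the fraction field, not over Z[x].     *)
Definition irreducible_elt (R : idomainType) (x : R) : Prop :=
  [/\ x != 0, x \isn't a GRing.unit &
      forall y z : R, x = y * z -> y \is a GRing.unit \/ z \is a GRing.unit].

Definition is_factor (R : idomainType) (x y : R) : Prop :=
  exists z : R, y = x * z.

Definition Zadjoin (a z : algC) : Prop :=
  exists p : {poly int}, z = (map_poly intr p).[a].

Definition Qadjoin (a z : algC) : Prop :=
  exists p q : {poly rat},
    (map_poly ratr q).[a] != 0 /\
    z = (map_poly ratr p).[a] / (map_poly ratr q).[a].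

Definition ring_of_integers (K : algC -> Prop) (z : algC) : Prop :=
  K z /\ integralOver (intr : int -> algC) z.

Definition monogenic (f : {poly int}) : Prop :=
  irreducible_elt f /\
  exists a : algC, root (map_poly intr f) a /\
    forall z : algC, Zadjoin a z <-> ring_of_integers (Qadjoin a) z.

(* Main.v *)
Require Import Defs.
From mathcomp Require Import all_boot all_order all_algebra all_field.
From mathcomp Require Import cyclic ring.

(** Let [n] be odd and [a] a root of [F_n].  Writing [a = y + w] with
    [y * w = -1], Binet's formula [F_n(y + w) * (y - w) = y ^+ n - w ^+ n]
    gives [y ^+ n = w ^+ n], hence [y ^+ (2 * n) = -1]: [y] is a root of unity,
    and [Z[y]] is integrally closed in [Q(y)].  An integral [z] in [Q(a)] thus
    lies in [Z[y] = Z[a] + Z[a] y] ([Zadjoin_quadratic]).  As [y ^+ (2 * n).-1 =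
    w] and [(2 * n).-1] is prime to [4 * n], some field automorphism exchanges
    [y] and [w] ([swap_automorphism]); it fixes [a], hence [z].  Comparing
    [z = A + B y = A + B w] and using [y <> w] leaves [B = 0], that is,
    [z] is in [Z[a]].  The case [y = w], where Binet's formula says nothing, is
    excluded by [F_n(2 y) = n y ^+ n.-1 <> 0].

    That [S = Z[zeta]] is integrally closed for every root of unity [zeta]
    ([Zadjoin_root_of_unity_closed]) is proved without discriminants.  An
    element of [Q(zeta)] has a multiple by a positive integer in [S], so it is
    enough to divide by one prime [p] at a time.  Let [zeta] have order
    [N = m * p ^ k] with [m] prime to [p], and take [pi = 1 - zeta ^+ m] if
    [0 < k], and [pi = p] otherwise.  Then [pi] divides [p], [p] divides a power
    of [pi], and [zeta ^+ m] is [1] modulo [pi].  Let [f] be such that [p ^ f] is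
    [1] modulo [m].  The power map of exponent [p ^ f] is additive modulo [p]
    and fixes [zeta] modulo [pi], so it is the identity of [S / pi]
    ([Zdvd_frobenius]), and [S / pi] is reduced.  If [z] is integral and [pi * z]
    is in [S], the powers of [z] have bounded denominators, so [pi * z] is
    nilpotent modulo [pi] ([Zdvd_integral_nilpotent]); hence [pi] divides
    [pi * z] in [S], which means that [z] is in [S].  Repeating this along a
    power of [pi] that [p] divides gets rid of [p]. *)

Set Implicit Arguments.
Unset Strict Implicit.
Unset Printing Implicit Defensive.

Import GRing.Theory Num.Theory.
Local Open Scope ring_scope.

(** * The ring generated by an algebraic number *)

Lemma ZadjoinD (a u v : algC) :
  Zadjoin a u -> Zadjoin a v -> Zadjoin a (u + v).
Proof. by case=> P -> [Q ->]; exists (P + Q); rewrite rmorphD hornerD. Qed.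

Lemma ZadjoinN (a u : algC) : Zadjoin a u -> Zadjoin a (- u).
Proof. by case=> P ->; exists (- P); rewrite rmorphN hornerN. Qed.

Lemma ZadjoinB (a u v : algC) :
  Zadjoin a u -> Zadjoin a v -> Zadjoin a (u - v).
Proof. by move=> Su Sv; apply/ZadjoinD/ZadjoinN. Qed.

Lemma ZadjoinM (a u v : algC) :
  Zadjoin a u -> Zadjoin a v -> Zadjoin a (u * v).
Proof. by case=> P -> [Q ->]; exists (P * Q); rewrite rmorphM hornerM. Qed.

Lemma Zadjoin_int (a : algC) (c : int) : Zadjoin a c%:~R.
Proof. by exists c%:P; rewrite map_polyC hornerC. Qed.

Lemma Zadjoin_nat (a : algC) (n : nat) : Zadjoin a n%:R.
Proof. exact: (Zadjoin_int a n). Qed.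

Lemma Zadjoin1 (a : algC) : Zadjoin a 1.
Proof. exact: (Zadjoin_nat a 1). Qed.

Lemma Zadjoin_self (a : algC) : Zadjoin a a.
Proof. by exists 'X; rewrite map_polyX hornerX. Qed.

Lemma ZadjoinX (a u : algC) (n : nat) : Zadjoin a u -> Zadjoin a (u ^+ n).
Proof.
move=> Su; elim: n => [|n IHn]; first exact: Zadjoin1.
by rewrite exprS; apply: ZadjoinM.
Qed.

Lemma Zadjoin_sum (a : algC) (n : nat) (F : 'I_n -> algC) :
  (forall i, Zadjoin a (F i)) -> Zadjoin a (\sum_i F i).
Proof.
move=> SF; elim/big_ind: _ => // [|u v]; last exact: ZadjoinD.
exact: Zadjoin_nat a 0.
Qed.

Lemma Zadjoin_trans (a b u : algC) :
  Zadjoin b a -> Zadjoin a u -> Zadjoin b u.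
Proof.
case=> Q -> [P ->]; exists (P \Po Q).
by rewrite map_comp_poly horner_comp.
Qed.

Lemma Zadjoin_integral (a u : algC) :
  integralOver (intr : int -> algC) a -> Zadjoin a u ->
  integralOver (intr : int -> algC) u.
Proof.
move=> Ia [P ->]; apply: integral_horner => //.
by apply/integral_poly => i; rewrite coef_map; apply: integral_id.
Qed.

Lemma integralOver_root_of_unity (N : nat) (zeta : algC) :
  (0 < N)%N -> zeta ^+ N = 1 -> integralOver (intr : int -> algC) zeta.
Proof.
move=> N_gt0 zetaN; exists ('X^N - 1); first exact: monicXnsubC.
by rewrite rmorphB rmorphXn /= map_polyX rmorph1 rootE !hornerE zetaN subrr.
Qed.

Lemma rmorph_Zadjoin (u : {rmorphism algC -> algC}) (a v : algC) :
  u a = a -> Zadjoin a v -> u v = v.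
Proof.
move=> ua [P ->]; rewrite -horner_map /= ua -map_poly_comp; congr (_.[_]).
by apply: eq_map_poly => c /=; rewrite rmorph_int.
Qed.

(** * Divisibility in that ring *)

(** The dividend [u] ranges over [algC], so that [Zdvd a d u] says that [u] is in
    the ideal generated by [d]; [u] and [v] are congruent modulo [d] when
    [Zdvd a d (u - v)]. *)
Definition Zdvd (a d u : algC) : Prop := exists2 s, Zadjoin a s & u = d * s.

Lemma Zdvd0 (a d : algC) : Zdvd a d 0.
Proof. by exists 0; rewrite ?mulr0 //; apply: Zadjoin_nat a 0. Qed.

Lemma ZdvdD (a d u v : algC) : Zdvd a d u -> Zdvd a d v -> Zdvd a d (u + v).
Proof. by case=> s Ss -> [t St ->]; exists (s + t); [apply: ZadjoinD|ring]. Qed.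

Lemma ZdvdN (a d u : algC) : Zdvd a d u -> Zdvd a d (- u).
Proof. by case=> s Ss ->; exists (- s); [apply: ZadjoinN|ring]. Qed.

Lemma ZdvdMl (a d u v : algC) : Zadjoin a u -> Zdvd a d v -> Zdvd a d (u * v).
Proof. by move=> Su [s Ss ->]; exists (u * s); [apply: ZadjoinM|ring]. Qed.

Lemma Zdvd_trans (a d e u : algC) : Zdvd a d e -> Zdvd a e u -> Zdvd a d u.
Proof.
case=> s Ss -> [t St ->]; exists (s * t); last by rewrite mulrA.
exact: ZadjoinM.
Qed.

Lemma Zdvd_subX1 (a u : algC) (n : nat) :
  Zadjoin a u -> Zdvd a (1 - u) (u ^+ n - 1).
Proof.
move=> Su; exists (- \sum_(i < n) u ^+ i); last by rewrite subrX1; ring.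
by apply/ZadjoinN/Zadjoin_sum => i; apply: ZadjoinX.
Qed.

(** * The Frobenius map *)

Lemma exprD_prime (R : comNzRingType) (p : nat) (x y : R) :
  prime p -> exists w, (x + y) ^+ p = x ^+ p + y ^+ p + w *+ p.
Proof.
case: p => // p pr_p.
exists (\sum_(i < p)
          x ^+ (p.+1 - i.+1) * y ^+ i.+1 *+ ('C(p.+1, i.+1) %/ p.+1)).
rewrite exprDn big_ord_recl big_ord_recr /= subn0 bin0 subnn binn !expr0.
rewrite mulr1 mul1r !mulr1n -addrA; congr (_ + _); rewrite addrC.
congr (_ + _); rewrite -sumrMnl; apply: eq_bigr => i _.
rewrite /bump leq0n add1n -mulrnA divnK //.
by apply: prime_dvd_bin => //=; rewrite ltnS.
Qed.

Lemma exprD_prime_pow (R : comNzRingType) (p f : nat) (x y : R) :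
  prime p ->
  exists w, (x + y) ^+ (p ^ f) = x ^+ (p ^ f) + y ^+ (p ^ f) + w *+ p.
Proof.
move=> pr_p; elim: f => [|f [w IH]]; first by exists 0; rewrite mul0rn addr0.
rewrite expnSr !exprM IH.
have [w1 ->] := exprD_prime (x ^+ (p ^ f) + y ^+ (p ^ f)) (w *+ p) pr_p.
have [w2 ->] := exprD_prime (x ^+ (p ^ f)) (y ^+ (p ^ f)) pr_p.
exists (w2 + w * (w *+ p) ^+ p.-1 + w1).
have -> : (w *+ p) ^+ p = (w * (w *+ p) ^+ p.-1) *+ p.
  by rewrite -mulrnAl -exprS prednK // prime_gt0.
by rewrite !mulrnDl !addrA.
Qed.

Lemma Zdvd_exprD (a u v : algC) (p f : nat) :
  prime p -> Zadjoin a u -> Zadjoin a v ->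
  Zdvd a p%:R ((u + v) ^+ (p ^ f) - u ^+ (p ^ f) - v ^+ (p ^ f)).
Proof.
move=> pr_p [P ->] [Q ->].
have [w Ew] := exprD_prime_pow f P Q pr_p.
exists (map_poly intr w).[a]; first by exists w.
rewrite -hornerD -rmorphD -!horner_exp -!rmorphXn /= Ew !rmorphD /= !hornerD.
by rewrite rmorphMn hornerMn -mulr_natl /=; ring.
Qed.

(** The elements that the power map of exponent [q = p ^ f] fixes modulo [pi] form
    a ring: sums are handled by the additivity of that map modulo [p], a
    multiple of [pi], and opposites by adding [v] and [- v]; the latter
    avoids the sign of [(-1) ^+ q].  So it is enough that [a] is fixed. *)
Lemma Zdvd_frobenius (a pi u : algC) (p f : nat) :
  prime p -> Zdvd a pi p%:R -> Zdvd a pi (a ^+ (p ^ f) - a) ->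
  Zadjoin a u -> Zdvd a pi (u ^+ (p ^ f) - u).
Proof.
move=> pr_p pi_p fixa [P ->]; set q := (p ^ f)%N in fixa *.
have q_gt0 : (0 < q)%N by rewrite expn_gt0 prime_gt0.
pose fixed v := Zadjoin a v /\ Zdvd a pi (v ^+ q - v).
have fixedD v w : fixed v -> fixed w -> fixed (v + w).
  case=> Sv fv [Sw fw]; split; first exact: ZadjoinD.
  have -> : (v + w) ^+ q - (v + w) =
    ((v + w) ^+ q - v ^+ q - w ^+ q) + ((v ^+ q - v) + (w ^+ q - w)) by ring.
  apply: ZdvdD (ZdvdD _ _) => //.
  by apply: Zdvd_trans pi_p _; apply: Zdvd_exprD.
have fixedN v : fixed v -> fixed (- v).
  case=> Sv fv; split; first exact: ZadjoinN.
  have -> : (- v) ^+ q - - v =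
    - (((v - v) ^+ q - v ^+ q - (- v) ^+ q) + (v ^+ q - v)).
    by rewrite subrr expr0n eqn0Ngt q_gt0 /=; move: ((- v) ^+ q) => w; ring.
  apply/ZdvdN/ZdvdD => //; apply: Zdvd_trans pi_p _.
  by apply: Zdvd_exprD => //; apply: ZadjoinN.
have fixedM v w : fixed v -> fixed w -> fixed (v * w).
  case=> Sv fv [Sw fw]; split; first exact: ZadjoinM.
  have -> : (v * w) ^+ q - v * w = w ^+ q * (v ^+ q - v) + v * (w ^+ q - w).
    by rewrite exprMn; ring.
  by apply: ZdvdD; apply: ZdvdMl => //; apply: ZadjoinX.
have fixed_nat n : fixed n%:R.
  elim: n => [|n IHn].
    split; first exact: Zadjoin_nat.
    by rewrite expr0n eqn0Ngt q_gt0 subr0; apply: Zdvd0.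
  rewrite -addn1 natrD; apply: fixedD => //; split; first exact: Zadjoin_nat.
  by rewrite expr1n subrr; apply: Zdvd0.
suff [] : fixed (map_poly intr P).[a] by [].
elim/poly_ind: P => [|P c IHP].
  by rewrite rmorph0 horner0; apply: (fixed_nat 0).
rewrite rmorphD rmorphM /= map_polyX map_polyC hornerMXaddC; apply: fixedD.
  by apply: fixedM => //; split=> //; apply: Zadjoin_self.
case: c => n; first exact: fixed_nat.
by rewrite NegzE /= mulrNz; apply/fixedN/fixed_nat.
Qed.

(** A power map that is the identity modulo [pi] leaves no nilpotent element: by
    iteration [u] is congruent to [u ^+ (q ^ j)], a multiple of [u ^+ j]. *)
Lemma Zdvd_reduced (a pi : algC) (q : nat) :
  (1 < q)%N -> (forall u, Zadjoin a u -> Zdvd a pi (u ^+ q - u)) ->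
  forall (u : algC) (j : nat),
  Zadjoin a u -> Zdvd a pi (u ^+ j) -> Zdvd a pi u.
Proof.
move=> q_gt1 frob u j Su pi_uj.
have iter k : Zdvd a pi (u ^+ (q ^ k) - u).
  elim: k => [|k IHk]; first by rewrite expr1 subrr; apply: Zdvd0.
  have -> : u ^+ (q ^ k.+1) - u =
    ((u ^+ (q ^ k)) ^+ q - u ^+ (q ^ k)) + (u ^+ (q ^ k) - u).
    by rewrite expnSr exprM; ring.
  by apply: ZdvdD => //; apply: frob; apply: ZadjoinX.
have -> : u = u ^+ (q ^ j - j) * u ^+ j - (u ^+ (q ^ j) - u).
  by rewrite -exprD subnK ?(ltnW (ltn_expl _ _)) //; ring.
by apply/ZdvdD/ZdvdN => //; apply: ZdvdMl => //; apply: ZadjoinX.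
Qed.

(** * Integral elements over the ring generated by a root of unity *)

(** If [z] satisfies a monic equation of degree [r], then [pi ^+ r] is a common
    denominator of all powers of [z], whereas [(pi * z) ^+ r.+1] has one more
    factor [pi] than this denominator. *)
Lemma Zdvd_integral_nilpotent (a pi z : algC) :
  integralOver (intr : int -> algC) z -> Zadjoin a pi -> Zadjoin a (pi * z) ->
  exists j, Zdvd a pi ((pi * z) ^+ j).
Proof.
case=> g g_monic /eqP gz0 Spi Spiz; pose r := (size g).-1.
have size_g : size g = r.+1 by rewrite prednK // lt0n size_poly_eq0 monic_neq0.
have zr : z ^+ r = - \sum_(i < r) (g`_i)%:~R * z ^+ i.
  move: gz0; rewrite horner_coef size_map_poly_id0; last first.
    by rewrite (monicP g_monic) oner_neq0.
  rewrite size_g big_ord_recr /= coef_map /= -/(lead_coef g) (monicP g_monic).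
  rewrite mul1r addrC => /eqP; rewrite addr_eq0 => /eqP ->.
  by congr (- _); apply: eq_bigr => i _; rewrite coef_map.
have bounded k : Zadjoin a (pi ^+ r * z ^+ k).
  elim/ltn_ind: k => k IHk; have [k_lt_r | r_le_k] := ltnP k r.
    rewrite -(subnK (ltnW k_lt_r)) exprD -mulrA -exprMn.
    by apply: ZadjoinM; apply: ZadjoinX.
  rewrite -(subnK r_le_k) exprD zr mulrN mulrN mulr_sumr mulr_sumr.
  apply/ZadjoinN/Zadjoin_sum => i.
  have -> : pi ^+ r * (z ^+ (k - r) * ((g`_i)%:~R * z ^+ i)) =
    (g`_i)%:~R * (pi ^+ r * z ^+ (k - r + i)) by rewrite exprD; ring.
  apply: ZadjoinM; first exact: Zadjoin_int.
  by apply: IHk; rewrite -[ltnRHS](subnK r_le_k) ltn_add2l.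
exists r.+1, (pi ^+ r * z ^+ r.+1); first exact: bounded.
by rewrite exprMn exprS mulrA.
Qed.

(** Each step removes one factor [pi]: the product by [pi] is nilpotent modulo
    [pi], hence a multiple of [pi] by the absence of nilpotents. *)
Lemma Zadjoin_divX (a pi z : algC) (q e : nat) :
  (1 < q)%N -> (forall u, Zadjoin a u -> Zdvd a pi (u ^+ q - u)) ->
  integralOver (intr : int -> algC) a -> Zadjoin a pi -> pi != 0 ->
  integralOver (intr : int -> algC) z -> Zadjoin a (pi ^+ e * z) -> Zadjoin a z.
Proof.
move=> q_gt1 frob Ia Spi pi_neq0 Iz.
elim: e => [|e IHe]; first by rewrite mul1r.
rewrite exprS -mulrA => Spiz; apply: IHe.
have Iez : integralOver (intr : int -> algC) (pi ^+ e * z).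
  by apply: integral_mul => //; apply: Zadjoin_integral Ia _; apply: ZadjoinX.
have [j nilp] := Zdvd_integral_nilpotent Iez Spi Spiz.
have [s Ss] := Zdvd_reduced q_gt1 frob Spiz nilp.
by move/(mulfI pi_neq0)->.
Qed.

(** The element [pi] generates the radical of [p] in [Z[zeta]]: it is [p] itself
    when [p] does not divide the order, and otherwise [1 - zeta ^+ m], where
    [zeta ^+ m] has order the [p]-part of [N]. *)
Lemma Zadjoin_root_of_unity_prime (N p : nat) (zeta z : algC) :
  N.-primitive_root zeta -> prime p -> integralOver (intr : int -> algC) z ->
  Zadjoin zeta (p%:R * z) -> Zadjoin zeta z.
Proof.
move=> prim_zeta pr_p Iz Spz.
have N_gt0 := prim_order_gt0 prim_zeta.
have Sz := Zadjoin_self zeta.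
have Izeta : integralOver (intr : int -> algC) zeta.
  exact: integralOver_root_of_unity N_gt0 (prim_expr_order prim_zeta).
have [m co_pm defN] := pfactor_coprime pr_p N_gt0.
set k := logn p N in defN.
have m_gt0 : (0 < m)%N by move: N_gt0; rewrite defN muln_gt0 => /andP[].
pose f := totient m; have f_gt0 : (0 < f)%N by rewrite totient_gt0.
have q_gt1 : (1 < p ^ f)%N by rewrite -(exp1n f) ltn_exp2r // prime_gt1.
have [t defq] : exists t, (p ^ f = (m * t).+1)%N.
  have /eqP := Euler_exp_totient co_pm; rewrite eqn_mod_dvd ?(ltnW q_gt1) //.
  case/dvdnP=> t Et; exists t; rewrite mulnC -Et subn1 prednK //.
  exact: ltnW.
have [pi [e [Spi pi_neq0 pi_p fixz [s Ss pi_e]]]] : exists pi : algC, exists e,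
  [/\ Zadjoin zeta pi, pi != 0, Zdvd zeta pi p%:R,
      Zdvd zeta pi (zeta ^+ (p ^ f) - zeta) & Zdvd zeta p%:R (pi ^+ e)].
  case: (posnP k) => [k0 | k_gt0].
    exists p%:R, 1; split.
    - exact: Zadjoin_nat.
    - by rewrite pnatr_eq0 -lt0n prime_gt0.
    - by exists 1; rewrite ?mulr1 //; apply: Zadjoin1.
    (* As [m = N], [zeta ^+ (p ^ f)] equals [zeta]. *)
    - have mN : m = N by rewrite defN k0 muln1.
      rewrite defq exprS exprM mN (prim_expr_order prim_zeta) expr1n mulr1 subrr.
      exact: Zdvd0.
    - by exists 1; rewrite ?mulr1 //; apply: Zadjoin1.
  have Sm := ZadjoinX m Sz.
  have zetaN : (zeta ^+ m) ^+ (p ^ k) = 1.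
    by rewrite -exprM -defN (prim_expr_order prim_zeta).
  (* A primitive [p]-th root of unity that is [1] modulo [pi]: the vanishing sum
     of its [p] first powers is congruent to [p], so [pi] divides [p]. *)
  pose om := (zeta ^+ m) ^+ (p ^ k.-1).
  have om_neq1 : om != 1.
    rewrite /om -exprM -(prim_order_dvd prim_zeta) defN dvdn_pmul2l //.
    by rewrite -{1}(prednK k_gt0) dvdn_Pexp2l ?prime_gt1 // ltnn.
  have om_p : om ^+ p = 1 by rewrite /om -exprM -expnSr prednK.
  have sum_om : \sum_(i < p) om ^+ i = 0.
    have /eqP := subrX1 om p; rewrite om_p subrr eq_sym mulf_eq0 subr_eq0.
    by rewrite (negPf om_neq1) => /eqP.
  exists (1 - zeta ^+ m), (p ^ k)%N; split.
  - by apply: ZadjoinB => //; apply: Zadjoin1.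
  - apply: contra om_neq1; rewrite subr_eq0 => /eqP z1.
    by rewrite /om -z1 expr1n.
  - have -> : p%:R = - \sum_(i < p) (om ^+ i - 1).
      by rewrite sumrB sum_om sumr_const card_ord; ring.
    apply: ZdvdN; elim/big_ind: _ => [|u v|i _]; [exact: Zdvd0|exact: ZdvdD|].
    by rewrite /om -exprM; apply: Zdvd_subX1.
  - have -> : zeta ^+ (p ^ f) - zeta = zeta * ((zeta ^+ m) ^+ t - 1).
      by rewrite defq exprS exprM; ring.
    by apply: ZdvdMl => //; apply: Zdvd_subX1.
  (* Additivity of the power map on [(1 - zeta ^+ m) + zeta ^+ m = 1] shows that
     [p] divides [pi ^+ (p ^ k)]. *)
  - have S1 : Zadjoin zeta (1 - zeta ^+ m).
      by apply: ZadjoinB => //; apply: Zadjoin1.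
    have := Zdvd_exprD k pr_p S1 Sm; rewrite subrK expr1n zetaN => /ZdvdN.
    by rewrite addrAC subrr sub0r opprK.
have frob u : Zadjoin zeta u -> Zdvd zeta pi (u ^+ (p ^ f) - u).
  exact: Zdvd_frobenius.
apply: (Zadjoin_divX q_gt1 frob Izeta Spi pi_neq0 Iz (e := e)).
by rewrite pi_e mulrAC mulrC; apply: ZadjoinM.
Qed.

(** With [Qadjoin_denominator], this says that [Z[zeta]] is the ring of integers of
    [Q(zeta)]. *)
Lemma Zadjoin_root_of_unity_closed (N n : nat) (zeta z : algC) :
  N.-primitive_root zeta -> (0 < n)%N ->
  integralOver (intr : int -> algC) z ->
  Zadjoin zeta (n%:R * z) -> Zadjoin zeta z.
Proof.
move=> prim_zeta; elim/ltn_ind: n => n IHn n_gt0 Iz.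
have [n_le1 | n_gt1] := leqP n 1.
  by rewrite (@anti_leq n 1) ?n_le1 ?mul1r.
have pr_p := pdiv_prime n_gt1; have /dvdnP[m Em] := pdiv_dvd n.
have m_gt0 : (0 < m)%N by move: n_gt0; rewrite Em muln_gt0 => /andP[].
rewrite {1}Em mulnC natrM -mulrA => Snz.
apply: (IHn m) => //; first by rewrite Em ltn_Pmulr ?prime_gt1.
apply: (Zadjoin_root_of_unity_prime prim_zeta pr_p _ Snz).
by apply: integral_mul => //; apply: (integral_id _ m%:Z).
Qed.

(** * Denominators in the field generated by an algebraic number *)

(** A polynomial [q] not vanishing at [a] is prime to the minimal polynomial of
    [a], so a Bezout relation turns a quotient by [q(a)] into a polynomial in
    [a], whose coefficients have a common denominator. *)
Lemma Qadjoin_denominator (a z : algC) :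
  Qadjoin a z -> exists2 n : nat, (0 < n)%N & Zadjoin a (n%:R * z).
Proof.
case=> p [q [qa_neq0 ->]]; 
pose ev (r : {poly rat}) := (map_poly ratr r).[a] : algC.
have evM r1 r2 : ev (r1 * r2) = ev r1 * ev r2 by rewrite /ev rmorphM hornerM.
have evD r1 r2 : ev (r1 + r2) = ev r1 + ev r2 by rewrite /ev rmorphD hornerD.
have [m [_ m_monic] m_dvd] := minCpolyP a.
have ev_m : ev m = 0 by apply/eqP; rewrite -rootE m_dvd.
have co_qm : coprimep q m.
  have [h Eh] := dvdpP _ _ (dvdp_gcdr q m).
  have [l El] := dvdpP _ _ (dvdp_gcdl q m).
  have ev_g : ev (gcdp q m) != 0.
    by apply: contraNneq qa_neq0 => g0; rewrite -/(ev q) El evM g0 mulr0.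
  have m_h : m %| h.
    rewrite -m_dvd rootE -/(ev h); move/eqP: ev_m.
    by rewrite {1}Eh evM mulf_eq0 (negPf ev_g) orbF.
  have m_neq0 := monic_neq0 m_monic.
  have h_neq0 : h != 0 by apply: contraNneq m_neq0 => h0; rewrite Eh h0 mul0r.
  by move: m_h; rewrite {1}Eh -{2}[h]mulr1 dvdp_mul2l // dvdp1.
have [[r1 r2] /= Er] := Bezout_eq1_coprimepP _ _ co_qm.
have ev_r : ev r1 * ev q = 1.
  have := congr1 ev Er; rewrite evD !evM ev_m mulr0 addr0 => ->.
  by rewrite /ev rmorph1 hornerC.
have [P [b b_neq0 EP]] := rat_poly_scale (p * r1).
exists `|b|%N; first by rewrite absz_gt0.
have -> : ev p / ev q = b%:~R^-1 * (map_poly intr P).[a].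
  rewrite -[RHS](_ : ev (p * r1) = _); last first.
    rewrite EP /ev map_polyZ hornerZ fmorphV /= ratr_int; congr (_ * _.[_]).
    by rewrite -map_poly_comp; apply: eq_map_poly => c /=; rewrite ratr_int.
  rewrite evM; congr (_ * _); apply: (mulIf qa_neq0).
  by rewrite mulVf // -[RHS]ev_r.
rewrite mulrA; apply: ZadjoinM; last by exists P.
have bR : b%:~R != 0 :> algC by rewrite intr_eq0.
rewrite -[`|b|%N%:R]/((`|b|%N%:Z)%:~R) abszEsg rmorphM /= mulfK //.
exact: Zadjoin_int.
Qed.

(** * Roots of Fibonacci polynomials *)

Lemma fibpolySS n : fibpoly n.+2 = 'X * fibpoly n.+1 + fibpoly n.
Proof. by []. Qed.

Lemma fibpoly_binet (R : comNzRingType) (y w : R) n :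
  y * w = -1 -> (map_poly intr (fibpoly n)).[y + w] * (y - w) = y ^+ n - w ^+ n.
Proof.
move=> yw; pose F k := (map_poly intr (fibpoly k)).[y + w].
suff [] : F n * (y - w) = y ^+ n - w ^+ n
       /\ F n.+1 * (y - w) = y ^+ n.+1 - w ^+ n.+1 by [].
rewrite /F {F}; elim: n => [|n [IH0 IH1]].
  by split; rewrite ?rmorph0 ?rmorph1 ?horner0 ?hornerC ?mul0r ?mul1r ?expr0
                    ?subrr ?expr1.
split=> //; rewrite fibpolySS rmorphD rmorphM /= map_polyX hornerD hornerM hornerX.
rewrite mulrDl -mulrA IH0 IH1.
have -> : (y + w) * (y ^+ n.+1 - w ^+ n.+1) =
  y ^+ n.+2 - w ^+ n.+2 + y * w * (y ^+ n - w ^+ n) by rewrite !exprS; ring.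
by rewrite yw; ring.
Qed.

(** The degenerate case [y = w] of Binet's formula, in which the latter reads
    [0 = 0]. *)
Lemma fibpoly_double (R : comNzRingType) (y : R) n :
  y * y = -1 -> (map_poly intr (fibpoly n)).[y + y] * y = n%:R * y ^+ n.
Proof.
move=> yy; pose F k := (map_poly intr (fibpoly k)).[y + y].
suff [] : F n * y = n%:R * y ^+ n
       /\ F n.+1 * y = n.+1%:R * y ^+ n.+1 by [].
rewrite /F {F}; elim: n => [|n [IH0 IH1]].
  by split; rewrite ?rmorph0 ?rmorph1 ?horner0 ?hornerC ?mul0r ?mul1r ?expr1.
split=> //; rewrite fibpolySS rmorphD rmorphM /= map_polyX hornerD hornerM hornerX.
rewrite mulrDl -mulrA IH0 IH1 !exprS.
have -> : n%:R * y ^+ n = - n%:R * (y * y) * y ^+ n by rewrite yy; ring.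
by rewrite -[n.+2]addn2 -[n.+1]addn1 !natrD; ring.
Qed.

Lemma fibpoly_at0 n : odd n -> (fibpoly n).[0] = 1.
Proof.
rewrite -[n in odd n]odd_double_half => odd_n.
have -> : n = (n./2.*2).+1.
  rewrite -{1}[n]odd_double_half.
  by move: odd_n; rewrite oddD odd_double addbF oddb => ->.
elim: n./2 => [|k IHk]; first by rewrite hornerC.
by rewrite doubleS fibpolySS hornerD hornerM hornerX mul0r add0r.
Qed.

(** A constant factor of [F_n] divides [F_n(0) = 1]. *)
Lemma fibpoly_factor_root (n : nat) (f : {poly int}) :
  odd n -> f \isn't a GRing.unit -> is_factor f (fibpoly n) ->
  exists a : algC, root (map_poly intr f) a.
Proof.
move=> odd_n f_nonunit [g Eg].
apply/closed_rootP; rewrite size_map_inj_poly ?rmorph0 //; last exact: intr_inj.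
apply: contra f_nonunit => /eqP/eqP/size_poly1P[c _ Ec].
have := fibpoly_at0 odd_n; rewrite Eg Ec hornerM hornerC => cg1.
by apply/unitrP; exists g.[0]%:P; rewrite -!polyCM [_ * c]mulrC cg1.
Qed.

Lemma fibpoly_root_of_unity (n : nat) (a : algC) :
  odd n -> (map_poly intr (fibpoly n)).[a] = 0 ->
  exists y w, [/\ a = y + w, y * w = -1, y != w & y ^+ (2 * n) = -1].
Proof.
move=> odd_n Fa0; have n_gt0 : (0 < n)%N by case: (n) odd_n.
pose y := (a + sqrtC (a ^+ 2 + 4%:R)) / 2%:R; pose w := a - y.
have yw : y * w = -1.
  have : sqrtC (a ^+ 2 + 4%:R) ^+ 2 = a ^+ 2 + 4%:R by rewrite sqrtCK.
  rewrite /w /y; set s := sqrtC _ => Es.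
  have -> : (a + s) / 2%:R * (a - (a + s) / 2%:R) = (a ^+ 2 - s ^+ 2) / 4%:R.
    by field.
  by rewrite Es; field.
have Ea : a = y + w by rewrite /w addrC subrK.
have y_neq0 : y != 0.
  by apply/eqP => y0; move/eqP: yw; rewrite y0 mul0r eq_sym oppr_eq0 oner_eq0.
have y_neq_w : y != w.
  apply/eqP => Eyw; have yy : y * y = -1 by rewrite {2}Eyw.
  have Ea2 : a = y + y by rewrite {2}Eyw.
  have /esym/eqP := fibpoly_double n yy; rewrite -Ea2 Fa0 mul0r.
  rewrite mulf_eq0 pnatr_eq0 expf_eq0 (negPf y_neq0) andbF orbF.
  by rewrite -leqn0 leqNgt n_gt0.
have y2n : y ^+ (2 * n) = -1.
  have /esym/eqP := fibpoly_binet n yw; rewrite -Ea Fa0 mul0r subr_eq0 => /eqP ynwn.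
  by rewrite mulnC exprM expr2 {2}ynwn -exprMn yw -signr_odd odd_n.
by exists y, w.
Qed.

(** Powers with exponent prime to [4 * n] extend from the [4 * n]-th roots of unity
    to field automorphisms. *)
Lemma swap_automorphism (n : nat) (y w : algC) :
  (0 < n)%N -> y * w = -1 -> y ^+ (2 * n) = -1 ->
  exists u : {rmorphism algC -> algC}, u y = w /\ u w = y.
Proof.
move=> n_gt0 yw y2n.
have y_neq0 : y != 0.
  by apply/eqP => y0; move/eqP: yw; rewrite y0 mul0r eq_sym oppr_eq0 oner_eq0.
have w_neq0 : w != 0.
  by apply/eqP => w0; move/eqP: yw; rewrite w0 mulr0 eq_sym oppr_eq0 oner_eq0.
have y4n : y ^+ (4 * n) = 1.
  by rewrite -[(4 * n)%N]/(2 * 2 * n)%N mulnAC exprM y2n sqrrN expr1n.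
have n2_gt0 : (0 < 2 * n)%N by rewrite muln_gt0.
have co_n : coprime (2 * n).-1 (4 * n).
  have co2n : coprime (2 * n).-1 (2 * n).
    by rewrite -{2}(prednK n2_gt0) coprimenS.
  rewrite -[(4 * n)%N]/(2 * 2 * n)%N -mulnA coprimeMr co2n andbT.
  by move: co2n; rewrite coprimeMr => /andP[].
have [u u_root] := Qn_aut_exists co_n.
have uy : u y = w.
  by apply: (mulfI y_neq0); rewrite u_root // -exprS prednK // y2n yw.
exists u; split=> //; apply: (mulfI w_neq0).
by rewrite -{1}uy -rmorphM yw rmorphN1 mulrC yw.
Qed.

Lemma Zadjoin_quadratic (a y v : algC) :
  y * y = a * y + 1 -> Zadjoin y v ->
  exists A B, [/\ Zadjoin a A, Zadjoin a B & v = A + B * y].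
Proof.
move=> y2 [P ->]; elim/poly_ind: P => [|P c [A [B [SA SB E]]]].
  exists 0, 0; rewrite rmorph0 horner0 mul0r addr0.
  by split=> //; apply: (Zadjoin_nat a 0).
exists (B + c%:~R), (A + B * a); split.
- by apply: ZadjoinD => //; apply: Zadjoin_int.
- by apply: ZadjoinD => //; apply: ZadjoinM => //; apply: Zadjoin_self.
rewrite rmorphD rmorphM /= map_polyX map_polyC hornerMXaddC E /=.
by rewrite mulrDl -mulrA y2; ring.
Qed.

Theorem theorem1p1 (n : nat) (f : {poly int}) :
  odd n -> irreducible_elt f -> is_factor f (fibpoly n) -> monogenic f.
Proof.
move=> odd_n irr_f f_dvd; split=> //.
have n_gt0 : (0 < n)%N by case: (n) odd_n.
have [a fa0] : exists a : algC, root (map_poly intr f) a.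
  by case: irr_f => _ f_nonunit _; apply: fibpoly_factor_root odd_n _ f_dvd.
exists a; split=> //.
have Fa0 : (map_poly intr (fibpoly n)).[a] = 0.
  by have [g ->] := f_dvd; rewrite rmorphM hornerM (eqP fa0) mul0r.
have [y [w [Ea yw y_neq_w y2n]]] := fibpoly_root_of_unity odd_n Fa0.
have y_neq0 : y != 0.
  by apply/eqP => y0; move/eqP: yw; rewrite y0 mul0r eq_sym oppr_eq0 oner_eq0.
have n4_gt0 : (0 < 4 * n)%N by rewrite muln_gt0.
have y4n : y ^+ (4 * n) = 1.
  by rewrite -[(4 * n)%N]/(2 * 2 * n)%N mulnAC exprM y2n sqrrN expr1n.
have [u [uy uw]] := swap_automorphism n_gt0 yw y2n.
have ua : u a = a by rewrite Ea rmorphD uy uw addrC.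
have Sya : Zadjoin y a.
  have Sy := Zadjoin_self y.
  have -> : a = y - y ^+ (4 * n).-1.
    rewrite Ea; congr (_ + _); apply: (mulfI y_neq0).
    by rewrite mulrN -exprS prednK // y4n yw.
  by apply: ZadjoinB => //; apply: ZadjoinX.
have Ia := Zadjoin_integral (integralOver_root_of_unity n4_gt0 y4n) Sya.
move=> z; split=> [Sz | [Kz Iz]].
  split; last exact: Zadjoin_integral Sz.
  case: Sz => P ->; exists (map_poly intr P), 1.
  rewrite rmorph1 hornerC divr1 oner_neq0 -map_poly_comp; split=> //.
  by congr (_.[_]); apply: eq_map_poly => c /=; rewrite ratr_int.
have [M M_gt0 SMz] := Qadjoin_denominator Kz.
have uz : u z = z.
  have M_neq0 : M%:R != 0 :> algC by rewrite pnatr_eq0 -lt0n.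
  by apply: (mulfI M_neq0); rewrite -[RHS](rmorph_Zadjoin ua SMz) rmorphM rmorph_nat.
have Syz : Zadjoin y z.
  have [N prim_y _] := prim_order_exists n4_gt0 y4n.
  exact: Zadjoin_root_of_unity_closed prim_y M_gt0 Iz (Zadjoin_trans Sya SMz).
have y2 : y * y = a * y + 1 by rewrite Ea mulrDl [w * y]mulrC yw; ring.
have [A [B [SA SB Ez]]] := Zadjoin_quadratic y2 Syz.
(* Now [u z = z] reads [A + B * w = A + B * y]. *)
move: uz; rewrite Ez rmorphD rmorphM.
rewrite (rmorph_Zadjoin ua SA) (rmorph_Zadjoin ua SB) uy => /addrI /eqP.
rewrite -subr_eq0 -mulrBr mulf_eq0 subr_eq0 [w == y]eq_sym (negPf y_neq_w) orbF.
by move/eqP ->; rewrite mul0r addr0.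
Qed.
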